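(* For any $\gamma\in(0,1]$ the Weibull distribution with parameter $\gamma$ is a scale mixture of half-normal laws: $$W_{\gamma}\stackrel{d}{=}|X|\,\sqrt{2W_1V_{\gamma}^2},$$ where the random variables $X$, $W_1$, $V_\gamma$ on the right-hand side are independent.
   Context: $\stackrel{d}{=}$ denotes equality in distribution. For $\gamma>0$, $W_\gamma$ is a random variable with the Weibull distribution $\mathsf P(W_\gamma<x)=[1-e^{-x^\gamma}]\mathbf 1(x\ge 0)$; in particular $W_1$ is standard exponential. $X$ is a standard normal random variable; the law of $|X|$ is called half-normal. For $\gamma\in(0,1)$, $S_{\gamma,1}$ is a positive random variable with the one-sided strictly stable distribution with characteristic exponent $\gamma$, normalized so that $\mathsf E e^{-sS_{\gamma,1}}=e^{-(2s)^\gamma}$ for $s\ge 0$; for $\gamma=1$ this means $S_{1,1}=2$ almost surely. $V_\gamma=2S_{\gamma,1}^{-1}$. *)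

(* Defs.v *)
From HB Require Import structures.
From mathcomp Require Import all_boot all_order all_algebra.
From mathcomp Require Import all_classical all_reals all_analysis.

Set Implicit Arguments.
Unset Strict Implicit.
Unset Printing Implicit Defensive.

Import Order.TTheory GRing.Theory Num.Theory.
Import numFieldNormedType.Exports.

Local Open Scope classical_set_scope.
Local Open Scope ring_scope.

(* Laws are compared on measurable sets only: the values of the set functions
   P and [distribution P X] on non-measurable sets carry no information. *)

Definition eq_distr (R : realType)
    (d1 : measure_display) (T1 : measurableType d1) (P1 : probability T1 R)
    (d2 : measure_display) (T2 : measurableType d2) (P2 : probability T2 R)
    (Y1 : T1 -> R) (Y2 : T2 -> R) : Prop :=
  forall B : set R, measurable B -> P1 (Y1 @^-1` B) = P2 (Y2 @^-1` B).

(* Some of the B_i may be the whole line, so the pairwise product rules are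
   included. *)
Definition independent3 (R : realType) (d : measure_display)
    (T : measurableType d) (P : probability T R) (Y1 Y2 Y3 : T -> R) : Prop :=
  forall B1 B2 B3 : set R, measurable B1 -> measurable B2 -> measurable B3 ->
    P (Y1 @^-1` B1 `&` Y2 @^-1` B2 `&` Y3 @^-1` B3) =
    (P (Y1 @^-1` B1) * P (Y2 @^-1` B2) * P (Y3 @^-1` B3))%E.

Definition standard_normal (R : realType) (d : measure_display)
    (T : measurableType d) (P : probability T R) (X : {RV P >-> R}) : Prop :=
  forall B : set R, measurable B -> distribution P X B = normal_prob 0 1 B.

Definition weibull (R : realType) (d : measure_display)
    (T : measurableType d) (P : probability T R) (gamma : R)
    (W : {RV P >-> R}) : Prop :=
  forall x : R,
    P [set t | W t < x] =
    ((1 - expR (- (x `^ gamma))) * (if 0 <= x then 1 else 0))%:E.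

(* If S' and S'' are independent copies of S, then a S' + b S'' has the law of
   (a^gamma + b^gamma)^(1/gamma) S; the law of (S', S'') is the product of the
   law of S with itself. *)
Definition strictly_stable (R : realType) (d : measure_display)
    (T : measurableType d) (P : probability T R) (gamma : R)
    (S : {RV P >-> R}) : Prop :=
  forall a b : R, 0 < a -> 0 < b -> forall B : set R, measurable B ->
    (distribution P S \x distribution P S)%E
      [set p : R * R | B (a * p.1 + b * p.2)] =
    distribution P S [set x | B ((a `^ gamma + b `^ gamma) `^ gamma^-1 * x)].

(* The variable S_{gamma,1}. The Laplace transform fixes the scale; for
   gamma = 1 it is exp(-2s), that is, S = 2 almost surely. *)
Definition one_sided_stable (R : realType) (d : measure_display)
    (T : measurableType d) (P : probability T R) (gamma : R)
    (S : {RV P >-> R}) : Prop :=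
  [/\ P [set t | 0 < S t] = 1%E,
      strictly_stable gamma S &
      forall s : R, 0 <= s ->
        ('E_P[fun t => expR (- (s * S t))] =
         (expR (- ((2 * s) `^ gamma)))%:E)%E].

(* Since S > 0 almost surely, the convention 0^-1 = 0 is immaterial. *)
Definition mixingV (R : realType) (T : Type) (S : T -> R) : T -> R :=
  fun t => 2 * (S t)^-1.

(* Main.v *)
(** Given V = v > 0 and X = a <> 0, the event |X| sqrt(2 W1 V^2) >= x reads
    W1 >= (x/v)^2 / (2 a^2), whose probability is exp(-(x/v)^2 / (2 a^2)).
    Averaging over the normal variable X gives exp(-x/v), by the identity
    E exp(-c^2 / (2 X^2)) = exp(-c) for c > 0. Averaging over V = 2/S gives
    E exp(-(x/2) S) = exp(-x^gamma), the tail of the Weibull law. *)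
Require Import Defs.
From HB Require Import structures.
From mathcomp Require Import all_boot all_order all_algebra.
From mathcomp Require Import all_classical all_reals all_analysis.
From mathcomp Require Import measurable_realfun ring lra.
Import Order.TTheory GRing.Theory Num.Theory.
Import numFieldNormedType.Exports.
Local Open Scope classical_set_scope.
Local Open Scope ring_scope.

(** * The normal law and the Gaussian integral of exp(-c^2 / (2 t^2)) *)

Section NormalAnalysis.
Context {R : realType}.
Local Notation mu := (@lebesgue_measure R).
Implicit Types (c a t x : R).

(** The Radon-Nikodym derivative of the normal law and [normal_pdf] have the same integral over
    every measurable set, hence agree almost everywhere, and the change of variables for the
    derivative carries over to the density. *)
Lemma ge0_integral_normal_prob (m s : R) (f : R -> \bar R) :
    measurable_fun setT f -> (forall x, 0 <= f x)%E ->
  (\int[normal_prob m s]_x f x = \int[mu]_x (f x * (normal_pdf m s x)%:E))%E.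
Proof.
move=> mf f0.
have dom := normal_prob_dominates m s.
rewrite -(Radon_Nikodym_SigmaFinite.change_of_variables dom)//.
have intf := Radon_Nikodym_SigmaFinite.f_integrable dom.
apply: ae_eq_integral => //.
- by apply: emeasurable_funM => //; exact: measurable_int intf.
- apply: emeasurable_funM => //.
  by apply/measurable_EFinP; exact: measurable_normal_pdf.
- apply: ae_eqe_mul2l; apply: integral_ae_eq => //.
  + by apply/measurable_EFinP; exact: measurable_normal_pdf.
  + by move=> E _ mE; rewrite -Radon_Nikodym_SigmaFinite.f_integral.
Qed.

Definition normal_cdf x : R := (\int[mu]_(t in `]-oo, x]) normal_pdf 0 1 t)%R.

Lemma is_derive_normal_cdf x : is_derive x 1 normal_cdf (normal_pdf 0 1 x).
Proof.
have [||||dF <-] := @continuous_FTC1 R (normal_pdf 0 1) -oo%O x (x + 1).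
- by rewrite ltrDl.
- apply: (integrableS measurableT) => //.
  exact: integrable_normal_pdf.
- by rewrite ltNyr.
- exact/continuous_normal_pdf/oner_neq0.
- by rewrite derive1E; exact: derivableP.
Qed.

(** Under the normal law on the line, the identity is a random variable whose [cdf] is [normal_cdf]
    up to [fine]; this gives the limits at both infinities. *)
Let idTR : measurableTypeR R -> R := idfun.

#[local] HB.instance Definition _ :=
  @isMeasurableFun.Build _ _ _ _ idTR (@measurable_id _ _ setT).

Let normal_cdfE : normal_cdf = fine \o
  cdf (idTR : {RV (normal_prob 0 1 : probability (measurableTypeR R) R) >-> R}).
Proof. by []. Qed.

Lemma normal_cdfy : normal_cdf x @[x --> +oo] --> (1 : R).
Proof. by rewrite normal_cdfE; apply: fine_cvg; exact: cvg_cdfy1. Qed.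

Lemma normal_cdfNy : normal_cdf x @[x --> -oo] --> (0 : R).
Proof. by rewrite normal_cdfE; apply: fine_cvg; exact: cvg_cdfNy0. Qed.

(* The value at 0 is the limit there, so that the function is continuous; the
   convention 1 / 0 = 0 would give 1. *)
Definition rec_kernel c t : R :=
  if t == 0 then 0 else expR (- (c ^+ 2 / (2 * t ^+ 2))).

Lemma rec_kernel_ge0 c t : 0 <= rec_kernel c t.
Proof. by rewrite /rec_kernel; case: ifP => // _; exact: expR_ge0. Qed.

(** This is exp(-y) <= 1/y, from y <= 1 + y <= exp(y), at y = c^2 / (2 t^2). The bound squeezes the
    kernel to 0 at the origin. *)
Lemma rec_kernel_le c t : 0 < c -> rec_kernel c t <= 2 / c ^+ 2 * t ^+ 2.
Proof.
move=> c0; rewrite /rec_kernel; case: eqP => [->|/eqP t0].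
  by rewrite expr0n mulr0.
have t2 : 0 < t ^+ 2 by rewrite exprn_even_gt0.
have c2 : 0 < c ^+ 2 by rewrite exprn_gt0.
have -> : 2 / c ^+ 2 * t ^+ 2 = (c ^+ 2 / (2 * t ^+ 2))^-1.
  by field; rewrite t0 gt_eqF.
rewrite expRN lef_pV2 ?posrE ?expR_gt0//; last first.
  by rewrite divr_gt0// mulr_gt0.
by rewrite (le_trans _ (expR_ge1Dx _))// lerDr.
Qed.

Lemma continuous_rec_kernel c : 0 < c -> continuous (rec_kernel c).
Proof.
move=> c0 t; have [->|t0] := eqVneq t 0.
  rewrite /continuous_at {2}/rec_kernel eqxx.
  apply: (@squeeze_cvgr _ _ _ _ (fun=> 0) (fun t => 2 / c ^+ 2 * t ^+ 2)).
  - by near=> x; rewrite rec_kernel_ge0 rec_kernel_le.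
  - exact: cvg_cst.
  - rewrite -[X in _ --> X](_ : 2 / c ^+ 2 * 0 ^+ 2 = 0); last first.
      by rewrite expr0n mulr0.
    by apply: cvgM; [exact: cvg_cst|exact: exprn_continuous].
rewrite /continuous_at {2}/rec_kernel (negbTE t0).
apply: (@cvg_trans _ (expR (- (c ^+ 2 / (2 * x ^+ 2))) @[x --> t])).
  apply: near_eq_cvg; near=> x.
  rewrite /rec_kernel ifF//; apply/negbTE.
  by near: x; apply: cvgr_neq0 t0; exact: cvg_id.
apply: (@continuous_comp _ _ _ (fun x => - (c ^+ 2 / (2 * x ^+ 2))) expR).
  2: exact: continuous_expR.
apply: cvgN; apply: cvgM; first exact: cvg_cst.
apply: cvgV; first by rewrite mulf_neq0// expf_neq0.
by apply: cvgM; [exact: cvg_cst|exact: exprn_continuous].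
Unshelve. all: by end_near. Qed.

Lemma rec_kernelN c t : rec_kernel c (- t) = rec_kernel c t.
Proof. by rewrite /rec_kernel oppr_eq0 sqrrN. Qed.

(** Completing the square: (t - c/t)^2 = t^2 - 2c + c^2/t^2, and the factor exp(-c) cancels the
    cross term. *)
Lemma normal_pdf_rec_kernelB c t : t != 0 ->
  expR (- c) * normal_pdf 0 1 (t - c / t) = rec_kernel c t * normal_pdf 0 1 t.
Proof.
move=> t0; rewrite /rec_kernel (negbTE t0) !normal_pdfE ?oner_neq0//=.
rewrite /normal_fun [LHS]mulrCA [RHS]mulrCA -!expRD; congr (_ * expR _).
by rewrite !subr0 expr1n; field.
Qed.

Lemma normal_pdf_rec_kernelD c t : t != 0 ->
  expR c * normal_pdf 0 1 (t + c / t) = rec_kernel c t * normal_pdf 0 1 t.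
Proof.
(* The kernel depends on [c] only through its square, so replacing [c] by [-c] changes only the
   left-hand side. *)
move=> t0; have := normal_pdf_rec_kernelB (- c) t t0.
rewrite opprK mulNr opprK => ->; congr (_ * _).
by rewrite /rec_kernel sqrrN.
Qed.

(* By the two previous lemmas the derivatives of the two terms are
   rec_kernel c t * normal_pdf 0 1 t times 1 + c / t^2 and 1 - c / t^2. The
   value at 0 is the limit at 0+. *)
Definition rec_primitive c t : R :=
  if t == 0 then expR c else
  expR (- c) * normal_cdf (t - c / t) + expR c * normal_cdf (t + c / t).

Lemma is_derive_rec_primitive c t : 0 < t ->
  is_derive t 1 (rec_primitive c) (2 * (rec_kernel c t * normal_pdf 0 1 t)).
Proof.
move=> t0; have tn0 : t != 0 by rewrite gt_eqF.
pose G s :=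
  expR (- c) * normal_cdf (s - c / s) + expR c * normal_cdf (s + c / s).
apply: (@near_eq_is_derive _ _ _ G).
  near=> s; rewrite /rec_primitive ifF//; apply/negbTE.
  by near: s; apply: cvgr_neq0 tn0; exact: cvg_id.
have dV : is_derive t 1 (fun s => c / s) (- (c / t ^+ 2)).
  have := is_deriveM (is_derive_cst c t 1)
    (@is_deriveV _ id _ _ _ tn0 (is_derive_id t 1)).
  move=> dcV; apply: (@is_derive_eq _ _ _ _ _ _ _ _ dcV).
  by rewrite /GRing.scale/=; field.
have dB : is_derive t 1 (fun s => s - c / s) (1 + c / t ^+ 2).
  by apply: is_derive_eq; rewrite opprK.
have dD : is_derive t 1 (fun s => s + c / s) (1 - c / t ^+ 2).
  by apply: is_derive_eq.
have d1 := @is_derive1_comp R normal_cdf (fun s => s - c / s) t _ _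
  (is_derive_normal_cdf (t - c / t)) dB.
have d2 := @is_derive1_comp R normal_cdf (fun s => s + c / s) t _ _
  (is_derive_normal_cdf (t + c / t)) dD.
have := is_deriveD (is_deriveZ (expR (- c)) d1) (is_deriveZ (expR c) d2).
move=> dG; apply: (@is_derive_eq _ _ _ G _ _ _ _ dG).
rewrite /GRing.scale/= !mulrA.
(* Both terms now carry the same product of kernel and density, and their weights 1 + c/t^2 and 1 -
   c/t^2 add up to 2. *)
rewrite normal_pdf_rec_kernelB// normal_pdf_rec_kernelD//.
by ring.
Unshelve. all: by end_near. Qed.

Lemma rec_primitive_cvgy c : 0 < c ->
  rec_primitive c t @[t --> +oo] --> expR (- c) + expR c.
Proof.
move=> c0; pose G s :=
  expR (- c) * normal_cdf (s - c / s) + expR c * normal_cdf (s + c / s).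
apply: (@cvg_trans _ (G t @[t --> +oo])).
  apply: near_eq_cvg; near=> s; rewrite /rec_primitive ifF//.
  by apply/negbTE; rewrite gt_eqF.
rewrite -[expR (- c)]mulr1 -[expR c]mulr1; apply: cvgD; apply: cvgM.
- exact: cvg_cst.
- apply: (@cvg_comp _ _ _ (fun s => s - c / s) normal_cdf _ +oo).
    apply/cvgryPge => A; near=> s.
    have s1 : 1 <= s by [].
    have s0 := lt_le_trans ltr01 s1.
    have : c / s <= c by rewrite ler_pdivrMr// ler_peMr// ltW.
    have : A + c <= s by [].
    by lra.
  exact: normal_cdfy.
- exact: cvg_cst.
- apply: (@cvg_comp _ _ _ (fun s => s + c / s) normal_cdf _ +oo).
    apply/cvgryPge => A; near=> s.
    have s0 : 0 < s by [].
    have : 0 <= c / s by rewrite divr_ge0// ltW.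
    have : A <= s by [].
    by lra.
  exact: normal_cdfy.
Unshelve. all: by end_near. Qed.

(** As t decreases to 0, t - c/t tends to -oo and t + c/t to +oo: the first term vanishes and the
    second tends to exp(c). *)
Lemma rec_primitive_cvg0 c : 0 < c ->
  rec_primitive c t @[t --> 0^'+] --> rec_primitive c 0.
Proof.
move=> c0; rewrite {2}/rec_primitive eqxx.
pose G s :=
  expR (- c) * normal_cdf (s - c / s) + expR c * normal_cdf (s + c / s).
apply: (@cvg_trans _ (G t @[t --> 0^'+])).
  apply: near_eq_cvg; near=> s; rewrite /rec_primitive ifF//.
  by apply/negbTE; rewrite gt_eqF.
(* The extra 1 absorbs s < 1 in the first limit: s - c/s < 1 - (1 + |A|) <= A. *)
have c_div (A s : R) : 0 < s -> s < c / (1 + `|A|) -> 1 + `|A| < c / s.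
  move=> s0; rewrite ltr_pdivlMr; last by rewrite ltr_wpDr.
  by rewrite mulrC -ltr_pdivlMr.
have cA_gt0 (A : R) : 0 < c / (1 + `|A|) by rewrite divr_gt0// ltr_wpDr.
rewrite -[expR c]add0r -[X in X + _](mulr0 (expR (- c))).
rewrite -[X in _ + X]mulr1; apply: cvgD; apply: cvgM.
- exact: cvg_cst.
- apply: (@cvg_comp _ _ _ (fun s => s - c / s) normal_cdf _ -oo).
    apply/cvgrNyPle => A; near=> s.
    have s1 : s < 1 by near: s; exact: nbhs_right_lt.
    have /c_div : 0 < s by [].
    have scA : s < c / (1 + `|A|) by near: s; exact: nbhs_right_lt.
    by move=> /(_ A scA); have := ler_norm (- A); rewrite normrN; lra.
  exact: normal_cdfNy.
- exact: cvg_cst.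
- apply: (@cvg_comp _ _ _ (fun s => s + c / s) normal_cdf _ +oo).
    apply/cvgryPge => A; near=> s.
    have s0 : 0 < s by [].
    have scA : s < c / (1 + `|A|) by near: s; exact: nbhs_right_lt.
    by have := c_div A s s0 scA; have := ler_norm A; lra.
  exact: normal_cdfy.
Unshelve. all: by end_near. Qed.

(** The integrand is even, so the integral is twice that over the positive half-line. With the
    factor 2 inside, [rec_primitive c] is a primitive there, and its increment is (exp(-c) + exp(c))
    - exp(c). *)
Lemma integral_rec_kernel_normal_pdf c : 0 < c ->
  (\int[mu]_t ((rec_kernel c t * normal_pdf 0 1 t)%:E) = (expR (- c))%:E)%E.
Proof.
move=> c0; pose h t := rec_kernel c t * normal_pdf 0 1 t.
have h0 t : 0 <= h t by rewrite mulr_ge0 ?rec_kernel_ge0 ?normal_pdf_ge0.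
have ch : continuous h.
  move=> t; apply: cvgM; first exact: continuous_rec_kernel.
  exact/continuous_normal_pdf/oner_neq0.
rewrite (ge0_symfun_integralT h0 ch); last first.
  move=> t; rewrite /h /= rec_kernelN; congr (_ * _).
  by rewrite normal_pdfE ?oner_neq0//= /normal_fun !subr0 sqrrN.
rewrite -set_itvcy -ge0_integralZl//=; last 2 first.
- by apply/measurable_EFinP/measurable_funTS; exact: continuous_measurable_fun.
- by move=> t _; rewrite lee_fin.
under eq_integral do rewrite -EFinM.
rewrite (@ge0_continuous_FTC2y _ _ (rec_primitive c) 0 (expR (- c) + expR c)).
- by rewrite /rec_primitive eqxx -EFinB addrK.
- by move=> t _; rewrite mulr_ge0.
- apply: continuous_subspaceT => t; apply: cvgM; first exact: cvg_cst.
  exact: ch.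
- exact: rec_primitive_cvgy.
- by move=> t t0; have [] := is_derive_rec_primitive c t t0.
- exact: rec_primitive_cvg0.
- move=> t; rewrite in_itv/= andbT => t0.
  by have [_] := is_derive_rec_primitive c t t0; rewrite derive1E.
Qed.

End NormalAnalysis.

(** * Joint law of three independent variables *)

Section RVPair.
Context d d1 d2 (T : measurableType d) (T1 : measurableType d1)
  (T2 : measurableType d2) (f : {mfun T >-> T1}) (g : {mfun T >-> T2}).

Definition rv_pair t := (f t, g t).

Let measurable_rv_pair : measurable_fun setT rv_pair.
Proof. by apply: measurable_fun_pair. Qed.

HB.instance Definition _ :=
  isMeasurableFun.Build _ _ _ _ rv_pair measurable_rv_pair.

End RVPair.
Arguments rv_pair {d d1 d2 T T1 T2}.

Section Independent3.
Context d (T : measurableType d) (R : realType) (P : probability T R)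
  (X Y Z : {RV P >-> R}).
Hypothesis XYZ : independent3 P X Y Z.
Local Open Scope ereal_scope.

(* For a fixed C both sides are measures in A, and they agree on rectangles. *)
Lemma independent3_pair (A : set (R * R)) (C : set R) :
  measurable A -> measurable C ->
  P (rv_pair X Y @^-1` A `&` Z @^-1` C) =
  P (Z @^-1` C) * (distribution P X \x distribution P Y) A.
Proof.
move=> mA mC.
have mZC : measurable (Z @^-1` C).
  by rewrite -[_ @^-1` _]setTI; exact: measurable_funPT.
pose c : {nonneg R} := NngNum (fine_ge0 (measure_ge0 P (Z @^-1` C))).
have cE : c%:num%:E = P (Z @^-1` C) by rewrite /= fineK// fin_num_measure.
pose m' : {measure set (R * R) -> \bar R} :=
  pushforward (mrestr P mZC) (rv_pair X Y).
have mXY : measurable_fun setT (rv_pair X Y) by exact: measurable_funPT.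
transitivity (m' mXY A) => //.
(* The constant P(Z in C) is absorbed into the law of [X], so that the right-hand side is again a
   product of two measures. *)
rewrite -(@product_measure_unique _ _ _ _ _
  (mscale c (distribution P X)) (distribution P Y) (m' mXY))//.
  rewrite /product_measure1 ge0_integral_mscale ?cE//.
  exact: measurable_fun_xsection.
move=> B1 B2 mB1 mB2.
transitivity (P (X @^-1` B1 `&` Y @^-1` B2 `&` Z @^-1` C)) => //.
by rewrite XYZ// -cE muleC muleA.
Qed.

(** Uniqueness of the product measure again, now for [Z] against the pair. [Z] comes first so that
    sections of [A] condition on its value. *)
Lemma independent3_joint (A : set (R * (R * R))) : measurable A ->
  P [set t | A (Z t, (X t, Y t))] =
  (distribution P Z \x (distribution P X \x distribution P Y)) A.
Proof.
move=> mA.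
pose PXY : probability (R * R)%type R := distribution P X \x distribution P Y.
pose m' : {measure set (R * (R * R)) -> \bar R} :=
  distribution P (rv_pair Z (rv_pair X Y)).
transitivity (m' A) => //.
rewrite -(@product_measure_unique _ _ _ _ _ (distribution P Z) PXY m')//.
move=> B1 B2 mB1 mB2; rewrite /m' /distribution /pushforward.
by rewrite -independent3_pair// setIC.
Qed.

End Independent3.

(** * Measurability of the mixing variable and the threshold for [W1] *)

Lemma measurable_invr (R : realType) : measurable_fun [set: R] (@GRing.inv R).
Proof.
rewrite -(setvU [set 0]); apply/measurable_funU => //.
  exact: measurableC.
split; last exact: measurable_fun_set1.
apply: open_continuous_measurable_fun; first by rewrite openC; exact: closed_eq.
by move=> x; rewrite inE => /= x0; apply: inv_continuous; apply/eqP.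
Qed.

Section MixingV.
Context d (T : measurableType d) (R : realType) (S : {mfun T >-> R}).

Let measurable_mixingV : measurable_fun setT (mixingV S).
Proof.
apply: measurable_funM => //; apply: (measurableT_comp (@measurable_invr R)).
exact: measurable_funPT.
Qed.

HB.instance Definition _ :=
  isMeasurableFun.Build _ _ _ _ (mixingV S) measurable_mixingV.

End MixingV.

Lemma ler_norm_sqrt (R : rcfType) (a v w x : R) : a != 0 -> 0 < v -> 0 < x ->
  (x <= `|a| * Num.sqrt (2 * w * v ^+ 2)) =
  ((x / v) ^+ 2 / (2 * a ^+ 2) <= w).
Proof.
move=> a0 v0 x0.
have na0 : 0 < `|a| by rewrite normr_gt0.
have xa0 : 0 < x / `|a| by rewrite divr_gt0.
rewrite [LHS](_ : _ = (x / `|a| <= Num.sqrt (2 * w * v ^+ 2))); last first.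
  by rewrite ler_pdivrMr// mulrC.
(* The strict comparison of roots requires positivity only of the larger radicand, here (x / |a|)^2.
   This covers negative [w] as well, where the root is 0 by convention and both sides are false. *)
rewrite leNgt -[X in _ < X](ger0_norm (ltW xa0)) -[`|x / _|]sqrtr_sqr.
rewrite ltr_sqrt ?exprn_gt0// -leNgt expr_div_n real_normK ?num_real//.
have a2 : 0 < a ^+ 2 by rewrite exprn_even_gt0.
have v2 : 0 < v ^+ 2 by rewrite exprn_gt0.
have -> : (x / v) ^+ 2 / (2 * a ^+ 2) = x ^+ 2 / (2 * a ^+ 2 * v ^+ 2).
  by field; rewrite a0 gt_eqF.
have av2 : 0 < 2 * a ^+ 2 * v ^+ 2 by apply: mulr_gt0 => //; exact: mulr_gt0.
by rewrite !ler_pdivrMr//; congr (_ <= _); ring.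
Qed.

(** * Tail of the mixture *)

Section Mixture.
Context (R : realType) d (T : measurableType d) (P : probability T R).

(** The coordinates are values (v, (a, w)) of V, X and W1, in the order of [independent3_joint]. *)
Definition mixture (p : R * (R * R)) : R :=
  `|p.2.1| * Num.sqrt (2 * p.2.2 * p.1 ^+ 2).

Lemma measurable_mixture : measurable_fun setT mixture.
Proof.
have msnd2 : measurable_fun setT (fun p : R * (R * R) => p.2.2).
  exact: measurableT_comp.
have msnd1 : measurable_fun setT (fun p : R * (R * R) => p.2.1).
  exact: measurableT_comp.
apply: measurable_funM; first exact: measurableT_comp.
apply: (measurableT_comp (continuous_measurable_fun (@sqrt_continuous R))).
apply: measurable_funM; first exact: measurable_funM.
exact: measurable_funX.
Qed.

Lemma weibull1_tail (W : {RV P >-> R}) c : weibull 1 W -> 0 <= c ->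
  P [set t | c <= W t] = (expR (- c))%:E.
Proof.
move=> Wlaw c0; have := Wlaw c; rewrite c0 mulr1 powRr1// => Wc.
have -> : [set t | c <= W t] = ~` [set t | W t < c].
  by apply/seteqP; split=> t /=; rewrite leNgt => /negP.
rewrite probability_setC; last first.
  have -> : [set t | W t < c] = setT `&` W @^-1` `]-oo, c[.
    by rewrite setTI; apply/seteqP; split=> t /=; rewrite in_itv.
  exact: measurable_funPT.
by rewrite Wc -EFinB; congr EFin; ring.
Qed.

Lemma ge0_integral_standard_normal (X : {RV P >-> R}) (f : R -> \bar R) :
  standard_normal X -> measurable_fun setT f -> (forall a, 0 <= f a)%E ->
  (\int[distribution P X]_a f a =
   \int[@lebesgue_measure R]_a (f a * (normal_pdf 0 1 a)%:E))%E.
Proof.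
move=> Xlaw mf f0.
rewrite -ge0_integral_normal_prob// ge0_integral_distribution//.
(* [X] is retyped with values in [measurableTypeR R], where [normal_prob] lives, so that its law can
   be compared with that measure. *)
pose X0 : T -> measurableTypeR R := X.
have mX0 : measurable_fun setT X0 by exact: (@measurable_funPT _ _ _ _ X).
pose X' : {RV P >-> measurableTypeR R} :=
  HB.pack X0 (isMeasurableFun.Build _ _ _ _ X0 mX0).
transitivity (\int[distribution P X']_a f a)%E.
  by rewrite ge0_integral_distribution.
by apply: eq_measure_integral => A mA _; exact: Xlaw.
Qed.

Lemma mixture_tail_cond (X W : {RV P >-> R}) (v x : R) :
  standard_normal X -> weibull 1 W -> 0 < v -> 0 < x ->
  (distribution P X \x distribution P W)%E
    (xsection [set p | x <= mixture p] v) = (expR (- (x / v)))%:E.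
Proof.
move=> Xlaw Wlaw v0 x0; have xv0 : 0 < x / v by rewrite divr_gt0.
have mK : measurable_fun setT (rec_kernel (x / v)).
  by apply: continuous_measurable_fun; exact: continuous_rec_kernel.
rewrite /product_measure1.
transitivity (\int[distribution P X]_a (rec_kernel (x / v) a)%:E)%E.
  apply: eq_integral => a _ /=.
  have -> : xsection (xsection [set p | x <= mixture p] v) a =
      [set w | x <= mixture (v, (a, w))].
    by apply/seteqP; split => w /=; rewrite /xsection/= !inE/= inE.
  rewrite /rec_kernel.
  (* At a = 0 the mixture equals 0 < x, so the section is empty, in agreement with the value 0 of
     the kernel there. *)
  have [->|a0] := eqVneq a 0.
    transitivity (distribution P W set0); last by rewrite measure0.
    congr (distribution P W _); apply/seteqP; split => // w.
    by rewrite /mixture/= normr0 mul0r leNgt x0.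
  rewrite -(weibull1_tail _ _ Wlaw); last first.
    by rewrite divr_ge0 ?sqr_ge0// mulr_ge0// sqr_ge0.
  rewrite /distribution /pushforward; congr (P _).
  by apply/seteqP; split => t /=; rewrite /mixture/= ler_norm_sqrt.
rewrite ge0_integral_standard_normal//; last 2 first.
- exact/measurable_EFinP.
- by move=> t; rewrite lee_fin rec_kernel_ge0.
by under eq_integral do rewrite -EFinM; rewrite integral_rec_kernel_normal_pdf.
Qed.

Lemma mixture_tail (gamma : R) (X W S : {RV P >-> R}) (x : R) :
  standard_normal X -> weibull 1 W -> one_sided_stable gamma S ->
  independent3 P X W (mixingV S) -> 0 < x ->
  P [set t | x <= mixture (mixingV S t, (X t, W t))] =
  (expR (- (x `^ gamma)))%:E.
Proof.
move=> Xlaw Wlaw [S0 _ SE] ind x0.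
have mA : measurable [set p | x <= mixture p].
  have -> : [set p | x <= mixture p] = setT `&` mixture @^-1` `[x, +oo[.
    by rewrite setTI; apply/seteqP; split=> p /=; rewrite in_itv/= andbT.
  exact: measurable_mixture.
pose PXW : probability (R * R)%type R :=
  (distribution P X \x distribution P W)%E.
have mPXW := @measurable_fun_xsection _ _ _ _ R PXW _ mA.
have := independent3_joint _ _ _ P X W (mixingV S) ind _ mA => /= ->.
rewrite {1}/product_measure1 ge0_integral_pushforward//= preimage_setT.
(* The Laplace transform of [S] is taken at x/2, since x/V = (x/2) S. *)
rewrite [in RHS](_ : x = 2 * (x / 2)); last by field.
rewrite -SE; last by rewrite divr_ge0// ltW.
have mS : measurable [set t | 0 < S t].
  have -> : [set t | 0 < S t] = setT `&` S @^-1` `]0, +oo[.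
    by rewrite setTI; apply/seteqP; split=> t /=; rewrite in_itv/= andbT.
  exact: measurable_funPT.
rewrite unlock; apply: ae_eq_integral => //.
- apply: (measurableT_comp mPXW); exact: measurable_funPT.
- apply/measurable_EFinP; apply: measurableT_comp => //.
  apply: measurableT_comp => //; apply: measurable_funM => //.
(* The conditional tail is available for v > 0, that is, where S > 0; the complement is a null
   set. *)
- exists (~` [set t | 0 < S t]); split; first exact: measurableC.
    by have := probability_setC P mS; rewrite S0 subee.
  apply: subsetC => t /= St _; rewrite mixture_tail_cond//.
    by congr (expR (- _))%:E; rewrite /mixingV invfM invrK mulrA.
  by rewrite divr_gt0.
Qed.

End Mixture.

(** * From tails to equality of laws *)

Theorem theorem1 (R : realType) (gamma : R)
    (gamma_gt0 : 0 < gamma) (gamma_le1 : gamma <= 1)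
    (d : measure_display) (T : measurableType d) (P : probability T R)
    (d' : measure_display) (T' : measurableType d') (P' : probability T' R)
    (Wgamma : {RV P' >-> R}) (X W1 S : {RV P >-> R})
    (Wgamma_law : weibull gamma Wgamma)
    (X_law : standard_normal X)
    (W1_law : weibull 1 W1)
    (S_law : one_sided_stable gamma S)
    (XW1V_indep : independent3 P X W1 (mixingV S)) :
  eq_distr P' P Wgamma
    (fun t => `|X t| * Num.sqrt (2 * W1 t * mixingV S t ^+ 2)).
Proof.
pose Z t := `|X t| * Num.sqrt (2 * W1 t * mixingV S t ^+ 2).
have mZ : measurable_fun setT Z.
  have mVXW : measurable_fun setT (rv_pair (mixingV S) (rv_pair X W1)).
    exact: measurable_funPT.
  exact: (measurableT_comp (measurable_mixture R) mVXW).
have Z_law x : P (Z @^-1` `]-oo, x[) = P' (Wgamma @^-1` `]-oo, x[).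
  have E (U : Type) (Y : U -> R) : Y @^-1` `]-oo, x[ = [set t | Y t < x].
    by apply/seteqP; split=> t /=; rewrite in_itv.
  rewrite !E Wgamma_law; case: (ltrP 0 x) => [x0|x0].
    rewrite (ltW x0) mulr1.
    have -> : [set t | Z t < x] = ~` [set t | x <= Z t].
      by apply/seteqP; split=> t /=; rewrite ltNge => /negP.
    rewrite probability_setC.
      rewrite EFinB; congr (_ - _)%E.
      exact: (mixture_tail _ _ _ P gamma X W1 S x X_law W1_law S_law).
    have -> : [set t | x <= Z t] = setT `&` Z @^-1` `[x, +oo[.
      by rewrite setTI; apply/seteqP; split=> t /=; rewrite in_itv/= andbT.
    exact: mZ.
  (* For x <= 0 the left side is 0 because Z >= 0. On the Weibull side the indicator vanishes for x
     < 0, while at x = 0 it is 1 and the other factor vanishes, as 0^gamma = 0 for gamma > 0. *)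
  rewrite (_ : [set t | Z t < x] = set0) ?measure0; last first.
    apply/seteqP; split=> // t /=; rewrite ltNge => /negP; apply.
    by rewrite (le_trans x0)// /Z mulr_ge0// sqrtr_ge0.
  case: ifPn => [x0'|_]; last by rewrite mulr0.
  have -> : x = 0 by apply/eqP; rewrite eq_le x0.
  by rewrite powR0 ?gt_eqF// oppr0 expR0 subrr mul0r.
pose Z' : {RV P >-> R} := HB.pack Z (isMeasurableFun.Build _ _ _ _ Z mZ).
move=> B mB; change (distribution P' Wgamma B = distribution P Z' B).
(* Open left half-lines generate the Borel sets and are stable under intersection, and those ending
   at natural numbers cover the line with finite mass; agreement on them therefore extends to every
   measurable set. *)
apply: (measure_unique (@RGenInftyO.G R) (fun n => `]-oo, n%:R[%classic)) => //.
- exact: RGenInftyO.measurableE.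
- move=> _ _ [x ->] [y ->]; exists (Num.min x y).
  by apply/seteqP; split=> t /=; rewrite !in_itv/= lt_min => /andP.
- by move=> n; exists n%:R.
- apply/seteqP; split=> // t _; exists (Num.truncn t).+1 => //=.
  by rewrite in_itv/= truncnS_gt.
- by move=> _ [x ->]; rewrite [RHS]Z_law.
- by move=> n; rewrite (le_lt_trans (probability_le1 _ _))// ltry.
Qed.
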